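(* Let $n>1$ be a positive integer with $\gcd(n,6)=1$, and let $u>v>0$ be integers. Then $$\prod_{d\mid n}\binom{ud}{vd}^{\mu(n/d)}\equiv 1-uv(v-u)\,\frac{B_{\phi(n)-2,\chi_n}}{\phi(n)-2}\,n^3\pmod{n^4}.$$
   Context: $\mu$ is the Möbius function and $\phi$ is Euler's totient function. $B_s$ denotes the $s$-th Bernoulli number, and for the trivial Dirichlet character $\chi_n$ modulo $n$ the generalized Bernoulli numbers are $B_{s,\chi_n}=B_s\prod_{p\mid n}(1-p^{s-1})$ (product over primes dividing $n$). For rational numbers $a,b$ and a positive integer $N$, $a\equiv b\pmod N$ means that $(a-b)/N$ is a rational number whose denominator is coprime to $N$. *)

(* Defs.v *)
From HB Require Import structures.
From mathcomp Require Import all_boot all_order all_algebra.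
Set Implicit Arguments.
Unset Strict Implicit.
Unset Printing Implicit Defensive.
Import Order.TTheory GRing.Theory Num.Theory.
Local Open Scope ring_scope.

Definition squarefree (n : nat) : bool :=
  (0 < n)%N && all (fun p => ~~ (p ^ 2 %| n)%N) (primes n).

Definition moebius (n : nat) : int :=
  if squarefree n then (-1) ^+ size (primes n) else 0.

(* [:: B_0; ...; B_n], built from B_0 = 1 and, for m >= 1,
   B_m = - (m + 1)^-1 * \sum_(k < m) 'C(m + 1, k) * B_k (so B_1 = - 1 / 2). *)
Fixpoint bernoulli_seq (n : nat) : seq rat :=
  if n is m.+1 then
    let s := bernoulli_seq m in
    rcons s (- (m.+2%:R)^-1 * \sum_(k < m.+1) 'C(m.+2, k)%:R * s`_k)
  else [:: 1].

Definition bernoulli_number (n : nat) : rat := (bernoulli_seq n)`_n.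

(* B_{s, chi_n} for the trivial Dirichlet character chi_n modulo n.  The
   exponent s - 1 is an integer, not a truncated natural number. *)
Definition bernoulli_triv_char (s n : nat) : rat :=
  bernoulli_number s * \prod_(p <- primes n) (1 - p%:R ^ (s%:Z - 1)).

Definition eqmod_rat (N : nat) (a b : rat) : Prop :=
  coprime `|denq ((a - b) / N%:R)|%N N.

Lemma size_bernoulli_seq n : size (bernoulli_seq n) = n.+1.
Proof. by elim: n => //= n IHn; rewrite size_rcons IHn. Qed.

Lemma nth_bernoulli_seq n k :
  (k <= n)%N -> (bernoulli_seq n)`_k = bernoulli_number k.
Proof.
elim: n => [|n IHn]; first by rewrite leqn0 => /eqP->.
rewrite leq_eqVlt => /predU1P[-> //|]; rewrite ltnS => le_kn.
by rewrite /= nth_rcons size_bernoulli_seq ltnS le_kn IHn.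
Qed.

Lemma bernoulli_number0 : bernoulli_number 0 = 1.
Proof. by []. Qed.

Lemma sum_bernoulli_number n :
  \sum_(k < n.+2) 'C(n.+2, k)%:R * bernoulli_number k = 0.
Proof.
rewrite big_ord_recr /= binSn {2}/bernoulli_number /=.
rewrite nth_rcons size_bernoulli_seq ltnn eqxx mulrA mulrN divff; last first.
  by rewrite pnatr_eq0.
rewrite mulN1r; apply/eqP; rewrite subr_eq0; apply/eqP/eq_bigr => k _.
by rewrite nth_bernoulli_seq // -ltnS ltn_ord.
Qed.

(* Main.v *)
Require Import Defs.
From HB Require Import structures.
From mathcomp Require Import all_boot all_order all_algebra cyclic.
From mathcomp Require Import ring lra zify.
Set Implicit Arguments.
Unset Strict Implicit.
Unset Printing Implicit Defensive.
Import Order.TTheory GRing.Theory Num.Theory.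
Local Open Scope ring_scope.

(** Everything takes place in the ring Z_(n) of rationals with denominator prime
    to n; all sums and products over j run over j prime to n. Put w = u - v,
    s = phi(n) - 2 and X = B_{s,chi_n} / s.

    Moebius inversion turns the product of binomials into
    L = prod_(j < wn) (vn + j) / j. Multiplying the factors at j and wn - j gives
    L^2 = prod_(j < wn) (1 + u v n^2 / (j (wn - j))), whence
    L^2 = 1 - u v w n^2 H mod n^4 with H = sum_(j < n) j^-2.

    It remains to see that H = -2 n X mod n^2. Write 2j = r_j + n c_j with r_j the
    residue; since j -> r_j permutes the units, expanding (2j - n c_j)^-2 gives
    3 H = n sum c_j j^-3 mod n^2. The same expansion of (2j - n c_j)^s, done modulo
    s n^2, combined with Faulhaber's formula sum_(j < n) j^s = n B_{s,chi_n} mod s n^2,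
    gives (2^s - 1) X = 2^(s-1) sum c_j j^(s-1) mod n. As 2^phi(n) = 1 mod n and 6 is
    prime to n, X lies in Z_(n) and -6 X = sum c_j j^-3 mod n. *)

(** * Rationals with denominator prime to n *)

Definition Zloc (n : nat) : {pred rat} := fun x => coprime `|denq x| n.

(** Any multiplier prime to n can replace the reduced denominator, so closure under sums and
    products only takes the product of two multipliers. *)
Lemma ZlocP n x :
  reflect (exists2 d : nat, coprime d n & d%:R * x \is a Num.int) (x \in Zloc n).
Proof.
apply: (iffP idP) => [nx | [d dn /intrP[a da]]].
  exists `|denq x|%N => //; apply/intrP; exists (numq x).
  by rewrite pmulrn abszE ger0_norm ?denq_ge0 // mulrC -numqE.
apply: coprime_dvdl dn.
have e : (d%:Z * numq x = a * denq x)%R.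
  by apply: (@intr_inj rat); rewrite !rmorphM /= numqE -da -pmulrn mulrA.
have : (denq x %| d%:Z * numq x)%Z by rewrite e dvdz_mull.
by rewrite Gauss_dvdzl // coprimezE coprime_sym coprime_num_den.
Qed.

Lemma Zloc_int n a : (a%:~R : rat) \in Zloc n.
Proof. by apply/ZlocP; exists 1%N; rewrite ?coprime1n // mul1r intr_int. Qed.

Lemma Zloc_nat n a : (a%:R : rat) \in Zloc n.
Proof. by rewrite pmulrn Zloc_int. Qed.

Lemma Zloc_subring n : subring_closed (Zloc n).
Proof.
split=> [|x y /ZlocP[a an ax] /ZlocP[b bn by_]|x y /ZlocP[a an ax] /ZlocP[b bn by_]].
- exact: (Zloc_nat n 1).
- apply/ZlocP; exists (a * b)%N; rewrite ?coprimeMl ?an //.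
  rewrite (_ : _ * _ = b%:R * (a%:R * x) - a%:R * (b%:R * y)); last by rewrite natrM; ring.
  by rewrite rpredB // rpredM // natr_int.
- apply/ZlocP; exists (a * b)%N; rewrite ?coprimeMl ?an //.
  rewrite (_ : _%:R * (x * y) = (a%:R * x) * (b%:R * y)); first by rewrite rpredM.
  by rewrite natrM; ring.
Qed.

HB.instance Definition _ n := GRing.isSubringClosed.Build rat (Zloc n) (Zloc_subring n).

Lemma Zloc_inv n j : coprime j n -> (j%:R^-1 : rat) \in Zloc n.
Proof.
case: j => [|j] jn; first by rewrite invr0 rpred0.
by apply/ZlocP; exists j.+1 => //; rewrite divff ?pnatr_eq0 // rpred1.
Qed.

Lemma Zloc_invz n (c : int) : coprime `|c| n -> (c%:~R^-1 : rat) \in Zloc n.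
Proof.
case: (intP c) => [|j|j] cn; first by rewrite invr0 rpred0.
  exact: Zloc_inv.
by rewrite rmorphN invrN rpredN Zloc_inv // -abszN.
Qed.

(** For a multiplier [d] of [z], the product [d (c + n z)] is the integer [c d + n a], prime to n
    because [c d] is. This yields the units by which the final steps divide. *)
Lemma Zloc_inv_add n (c : int) z : (1 < n)%N -> coprime `|c| n -> z \in Zloc n ->
  c%:~R + n%:R * z != 0 /\ (c%:~R + n%:R * z)^-1 \in Zloc n.
Proof.
move=> n1 cn /ZlocP[d dn /intrP[a da]].
have d0 : d%:R != 0 :> rat.
  rewrite pnatr_eq0; apply: contraTneq dn => ->.
  by rewrite /coprime gcd0n gtn_eqF.
have cdE : (c * d%:Z + n%:Z * a)%:~R = d%:R * (c%:~R + n%:R * z) :> rat.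
  by rewrite rmorphD !rmorphM /= -da -!pmulrn; ring.
have cop : coprime `|c * d%:Z + n%:Z * a| n.
  have : coprimez (c * d%:Z) n%:Z by rewrite coprimezE abszM coprimeMl cn.
  rewrite -[X in coprime _ X]/(`|n%:Z|%N) -coprimezE coprimez_sym.
  rewrite [coprimez (_ + _) _]coprimez_sym.
  by rewrite /coprimez addrC [_ * a]mulrC gcdzMDl.
split.
  apply: contraTneq cop => z0; move: cdE; rewrite z0 mulr0 => /eqP.
  by rewrite intr_eq0 => /eqP->; rewrite /coprime gcd0n gtn_eqF.
have -> : (c%:~R + n%:R * z)^-1 = d%:R * (c * d%:Z + n%:Z * a)%:~R^-1.
  by rewrite cdE invfM mulVKf.
by rewrite rpredM ?Zloc_nat ?Zloc_invz.
Qed.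

(** Congruence modulo [N Z_(n)]. The modulus is kept apart from n because [N = s n^2] occurs, where
    s may share primes with n. *)
Definition cong (n : nat) (N x y : rat) : bool := (x - y) / N \in Zloc n.

Lemma congP n N x y : N != 0 ->
  reflect (exists2 z, z \in Zloc n & x = y + N * z) (cong n N x y).
Proof.
move=> N0; apply: (iffP idP) => [xy | [z zn ->]].
  by exists ((x - y) / N) => //; rewrite mulrC divfK // addrC subrK.
by rewrite /cong addrAC subrr add0r mulrC mulKf.
Qed.

Lemma cong_refl n N x : cong n N x x.
Proof. by rewrite /cong subrr mul0r rpred0. Qed.

Lemma cong_trans n N y x z : cong n N x y -> cong n N y z -> cong n N x z.
Proof.
move=> xy yz; rewrite /cong (_ : _ / _ = (x - y) / N + (y - z) / N) ?rpredD //.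
by rewrite -mulrDl addrA subrK.
Qed.

Lemma congD n N x y x' y' :
  cong n N x y -> cong n N x' y' -> cong n N (x + x') (y + y').
Proof.
by move=> h h'; rewrite /cong opprD addrACA mulrDl rpredD.
Qed.

Lemma congB n N x y x' y' :
  cong n N x y -> cong n N x' y' -> cong n N (x - x') (y - y').
Proof.
by move=> h h'; rewrite congD // /cong -opprD mulNr rpredN.
Qed.

Lemma congMl n N z x y : z \in Zloc n -> cong n N x y -> cong n N (z * x) (z * y).
Proof. by move=> zn h; rewrite /cong -mulrBr -mulrA rpredM. Qed.

Lemma cong_scale n M N x y : M != 0 ->
  cong n (M * N) (M * x) (M * y) = cong n N x y.
Proof. by move=> M0; rewrite /cong -mulrBr -mulf_div divff ?mul1r. Qed.

Lemma cong_sum n N (I : Type) (r : seq I) (P : pred I) (F G : I -> rat) :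
  (forall i, P i -> cong n N (F i) (G i)) ->
  cong n N (\sum_(i <- r | P i) F i) (\sum_(i <- r | P i) G i).
Proof.
move=> FG; elim/big_rec2: _ => [|i x y Pi xy]; first exact: cong_refl.
by apply: congD; first exact: FG.
Qed.

Lemma ZlocD n x y : x \in Zloc n -> y \in Zloc n -> x + y \in Zloc n.
Proof. exact: rpredD. Qed.

Lemma ZlocN n x : x \in Zloc n -> - x \in Zloc n.
Proof. by rewrite rpredN. Qed.

Lemma ZlocM n x y : x \in Zloc n -> y \in Zloc n -> x * y \in Zloc n.
Proof. exact: rpredM. Qed.

Lemma ZlocX n x k : x \in Zloc n -> x ^+ k \in Zloc n.
Proof. exact: rpredX. Qed.

Ltac zloc := repeat lazymatch goal with
  | H : is_true (?x \in Zloc ?n) |- is_true (?x \in Zloc ?n) => exact: H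
  | |- is_true (_ + _ \in _) => apply: ZlocD
  | |- is_true (- _ \in _) => apply: ZlocN
  | |- is_true (_ * _ \in _) => apply: ZlocM
  | |- is_true (_ ^+ _ \in _) => apply: ZlocX
  | |- is_true (_%:R \in _) => apply: Zloc_nat
  | |- is_true (0 \in _) => apply: rpred0
  | |- is_true (1 \in _) => apply: rpred1
  | |- _ => assumption
  end.

(** * Moebius sums *)

Lemma squarefree_mul_prime p m : prime p -> (0 < m)%N ->
  squarefree (p * m) = ~~ (p %| m)%N && squarefree m.
Proof.
move=> pp m0; have p0 := prime_gt0 pp; have pm0 : (0 < p * m)%N by rewrite muln_gt0 p0.
rewrite /squarefree m0 pm0 /=; apply/allP/andP => [h | [pm /allP h] q].
  have pin : p \in primes (p * m) by rewrite mem_primes pp pm0 dvdn_mulr.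
  split; first by have := h _ pin; rewrite expnS expn1 dvdn_pmul2l.
  apply/allP => q; rewrite mem_primes => /and3P[qp _ qm].
  have /h : q \in primes (p * m) by rewrite mem_primes qp pm0 dvdn_mull.
  by apply: contra => h2; rewrite dvdn_mull.
rewrite mem_primes => /and3P[qp _ qpm].
have [->|qNp] := eqVneq q p; first by rewrite expnS expn1 dvdn_pmul2l.
have cqp : coprime q p by rewrite prime_coprime // dvdn_prime2.
rewrite Gauss_dvdr ?coprimeXl //; apply: h.
by rewrite mem_primes qp m0 -(Gauss_dvdr _ cqp).
Qed.

Lemma moebius_mul_prime p m : prime p -> (0 < m)%N -> ~~ (p %| m)%N ->
  moebius (p * m) = - moebius m.
Proof.
move=> pp m0 pm; rewrite /moebius squarefree_mul_prime // pm /=.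
case: ifP; rewrite ?oppr0 // => _.
have -> : size (primes (p * m)) = (size (primes m)).+1.
  rewrite -[RHS]/(size (p :: primes m)); apply/perm_size/uniq_perm.
  - exact: primes_uniq.
  - by rewrite /= primes_uniq mem_primes (negPf pm) !andbF.
  - by move=> q; rewrite primesM ?(prime_gt0 pp) // primes_prime // !inE.
by rewrite exprS mulN1r.
Qed.

Lemma moebius_eq0 n : ~~ squarefree n -> moebius n = 0.
Proof. by rewrite /moebius => /negPf->. Qed.

(* Induction by splitting off one prime p: only the divisors e and p * e with e coprime to p
   carry a nonzero Moebius value. *)
Lemma sum_moebius_mulf n (g : nat -> rat) : (0 < n)%N -> g 1%N = 1 ->
  (forall a b, (0 < a)%N -> (0 < b)%N -> g (a * b)%N = g a * g b) ->
  \sum_(e <- divisors n) (moebius e)%:~R * g e = \prod_(p <- primes n) (1 - g p).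
Proof.
move=> n0 g1 gM; have [k] := ubnP n; elim: k n n0 => // k IHk n n0 /ltnSE le_nk.
have [n1|n1] := leqP n 1.
  have -> : n = 1%N by case: n n0 n1 {le_nk} => [|[]].
  by rewrite big_nil big_seq1 g1 mulr1.
have [p pp pn] := pdivP n1; have p0 := prime_gt0 pp.
have [m pm defn] := pfactor_coprime pp n0.
have a0 : (0 < logn p n)%N by rewrite logn_gt0 mem_primes pp n0.
move: (logn p n) defn a0 => a defn a0.
have m0 : (0 < m)%N by case: m defn {pm} n0 => // ->.
have pNm : ~~ (p %| m)%N by rewrite -prime_coprime.
have mn : (m < n)%N.
  by rewrite defn -[ltnLHS]muln1 ltn_pmul2l // -[1%N](expn0 p) ltn_exp2l ?prime_gt1.
have mdn : (m %| n)%N by rewrite defn dvdn_mulr.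
have -> : \prod_(q <- primes n) (1 - g q) = (1 - g p) * \prod_(q <- primes m) (1 - g q).
  transitivity (\prod_(q <- p :: primes m) (1 - g q)); last by rewrite big_cons.
  apply/perm_big/uniq_perm.
  - exact: primes_uniq.
  - by rewrite /= primes_uniq mem_primes (negPf pNm) !andbF.
  - move=> q; rewrite defn primesM ?expn_gt0 ?p0 // primesX // (primes_prime pp).
    by rewrite !inE orbC.
rewrite -(IHk m) ?(leq_trans mn) //.
rewrite mulrBl mul1r mulr_sumr -sumrN.
(* With [n = m p^a], the divisors of n prime to p are those of m. Among the multiples of p only the
   squarefree ones count, and these are [p c] with c a squarefree divisor of m. *)
rewrite (bigID (fun e => p %| e)%N) /= addrC; congr (_ + _).
  rewrite -big_filter; apply/perm_big/uniq_perm.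
  - by rewrite filter_uniq // divisors_uniq.
  - exact: divisors_uniq.
  - move=> e; rewrite mem_filter -!dvdn_divisors //; apply/andP/idP => [[pe en]|em].
      by rewrite -(@Gauss_dvdl _ _ (p ^ a)) ?coprimeXr -?defn // coprime_sym prime_coprime.
    split; last exact: dvdn_trans em mdn.
    by apply: contra pNm => /dvdn_trans; apply.
rewrite (bigID squarefree) /= addrC big1 ?add0r; last first.
  by move=> e /andP[_ /moebius_eq0->]; rewrite mul0r.
transitivity (\sum_(e <- divisors m | squarefree e)
    - (g p * ((moebius e)%:~R * g e))); last first.
  rewrite [RHS](bigID squarefree) /= [X in _ = _ + X]big1 ?addr0 //.
  by move=> e /moebius_eq0->; rewrite mul0r mulr0 oppr0.
rewrite -big_filter -[RHS]big_filter.
transitivity (\sum_(e <- [seq (p * e)%N | e <- divisors m & squarefree e])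
    (moebius e)%:~R * g e).
  apply/perm_big/uniq_perm.
  - by rewrite filter_uniq // divisors_uniq.
  - rewrite map_inj_uniq ?filter_uniq ?divisors_uniq // => x y /eqP.
    by rewrite eqn_pmul2l // => /eqP.
  - move=> e; rewrite mem_filter -dvdn_divisors //.
    apply/andP/mapP => [[/andP[/dvdnP[c ->] sq] en] | [c]].
      exists c; last by rewrite mulnC.
      have c0 : (0 < c)%N by case: c sq {en}.
      move: sq; rewrite mulnC squarefree_mul_prime // => /andP[pc sq].
      rewrite mem_filter sq -dvdn_divisors //=.
      have : (c %| n)%N by apply: dvdn_trans en; rewrite dvdn_mulr.
      by rewrite defn Gauss_dvdl // coprimeXr // coprime_sym prime_coprime.
    rewrite mem_filter -dvdn_divisors // => /andP[sq cm] ->.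
    have c0 : (0 < c)%N by apply: dvdn_gt0 cm.
    have pc : ~~ (p %| c)%N by apply: contra pNm => /dvdn_trans; apply.
    rewrite squarefree_mul_prime // pc sq dvdn_mulr //= defn mulnC dvdn_mul //.
    by rewrite -[X in (X %| _)%N]expn1 dvdn_exp2l.
rewrite big_map big_seq_cond [RHS]big_seq_cond; apply: eq_bigr => e.
rewrite andbT mem_filter -dvdn_divisors // => /andP[sq em].
have e0 : (0 < e)%N by apply: dvdn_gt0 em.
have pe : ~~ (p %| e)%N by apply: contra pNm => /dvdn_trans; apply.
by rewrite gM // moebius_mul_prime // rmorphN /=; ring.
Qed.

Lemma sum_moebius n : (0 < n)%N -> \sum_(e <- divisors n) moebius e = (n == 1%N)%:R.
Proof.
move=> n0; apply: (@intr_inj rat); rewrite rmorph_sum /=.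
transitivity (\sum_(e <- divisors n) (moebius e)%:~R * (fun=> 1) e : rat).
  by apply: eq_bigr => e _; rewrite mulr1.
rewrite sum_moebius_mulf //.
have [->|n1] := eqVneq n 1%N; first by rewrite big_nil.
have {}n1 : (1 < n)%N by rewrite ltn_neqAle eq_sym n1.
have [p pp pn] := pdivP n1.
rewrite (big_rem p) /=; last by rewrite mem_primes pp n0.
by rewrite subrr mul0r.
Qed.

(** The divisors of n that divide k are the divisors of [gcdn k n]. *)
Lemma sum_moebius_coprime n k : (0 < n)%N ->
  \sum_(e <- divisors n | (e %| k)%N) moebius e = (coprime k n)%:R.
Proof.
move=> n0; have g0 : (0 < gcdn k n)%N by rewrite gcdn_gt0 n0 orbT.
rewrite /coprime -sum_moebius // -big_filter; apply/perm_big/uniq_perm.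
- by rewrite filter_uniq // divisors_uniq.
- exact: divisors_uniq.
- by move=> e; rewrite mem_filter -!dvdn_divisors // dvdn_gcd.
Qed.

(** * The product as a quotient over residues prime to n *)

Lemma big_multiples (R : Type) (idx : R) (op : Monoid.law idx) e m (F : nat -> R) :
  (0 < e)%N ->
  \big[op/idx]_(1 <= k < (m * e).+1 | (e %| k)%N) F k
  = \big[op/idx]_(1 <= i < m.+1) F (i * e)%N.
Proof.
move=> e0; elim: m => [|m IHm]; first by rewrite mul0n !big_geq.
rewrite (@big_cat_nat _ _ _ (m * e).+1) //=; last by rewrite ltnS mulSn leq_addl.
rewrite {}IHm [RHS]big_nat_recr //= mulSn addnC; congr (op _ _).
rewrite big_mkcond big_nat_recr /=; last by rewrite -{1}[(m * e)%N]addn0 ltn_add2l.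
rewrite big_nat_cond big1 => [|k]; last first.
  rewrite andbT => /andP[mk ke]; case: ifP => // /dvdnP[c kE]; move: mk ke; rewrite kE.
  by rewrite addnC -mulSn !ltn_pmul2r // => mc; rewrite ltnS leqNgt mc.
by rewrite dvdn_addr ?dvdn_mull // dvdnn Monoid.mul1m.
Qed.

Lemma fact_mul_expn e m : (0 < e)%N ->
  (m`! * e ^ m = \prod_(1 <= k < (m * e).+1 | e %| k) k)%N.
Proof.
move=> e0; rewrite big_multiples // big_split fact_prod /=; congr (_ * _)%N.
by rewrite prod_nat_const_nat subn1.
Qed.

Lemma prodr_expz (I : Type) (r : seq I) (P : pred I) (x : rat) (F : I -> int) :
  x != 0 -> \prod_(i <- r | P i) x ^ F i = x ^ (\sum_(i <- r | P i) F i).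
Proof.
move=> x0; elim/big_rec2: _ => [|i y z _ ->]; first by rewrite expr0z.
by rewrite expfzDr.
Qed.

Lemma prodf_expz (I : Type) (r : seq I) (P : pred I) (F : I -> rat) (k : int) :
  \prod_(i <- r | P i) F i ^ k = (\prod_(i <- r | P i) F i) ^ k.
Proof.
elim/big_rec2: _ => [|i y z _ ->]; first by rewrite exp1rz.
by rewrite expfzMl.
Qed.

(** The factor at e is the product of the multiples of e up to [m n]. After exchanging products, k
    carries the exponent given by the sum of [moebius e] over common divisors e of k and n: 1 if k
    is prime to n, 0 otherwise. *)
Lemma prod_fact_moebius n m : (0 < n)%N ->
  \prod_(e <- divisors n) (((m * (n %/ e))`! * e ^ (m * (n %/ e)))%:R : rat) ^ moebius e
  = \prod_(1 <= k < (m * n).+1 | coprime k n) k%:R.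
Proof.
move=> n0.
transitivity (\prod_(e <- divisors n)
   \prod_(1 <= k < (m * n).+1 | (e %| k)%N) (k%:R : rat) ^ moebius e).
  rewrite big_seq [RHS]big_seq; apply: eq_bigr => e; rewrite -dvdn_divisors // => en.
  by rewrite fact_mul_expn ?(dvdn_gt0 n0) // -mulnA divnK // prodf_expz natr_prod.
rewrite (exchange_big_dep xpredT) //= [RHS]big_mkcond big_nat [RHS]big_nat.
apply: eq_bigr => k /andP[k0 _].
rewrite prodr_expz ?pnatr_eq0 -?lt0n // sum_moebius_coprime //.
by case: coprime.
Qed.

Lemma divn_divn n d : (0 < n)%N -> (d %| n)%N -> (n %/ (n %/ d) = d)%N.
Proof. by move=> n0 dn; rewrite divnA // mulKn. Qed.

Lemma perm_divn_divisors n : (0 < n)%N ->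
  perm_eq (divisors n) [seq (n %/ e)%N | e <- divisors n].
Proof.
move=> n0; rewrite perm_sym; apply: uniq_perm (divisors_uniq n) _.
  rewrite map_inj_in_uniq ?divisors_uniq // => x y.
  rewrite -!dvdn_divisors // => xn yn xy.
  by rewrite -(divn_divn n0 xn) xy divn_divn.
move=> d; rewrite -dvdn_divisors //; apply/mapP/idP => [[e]|dn].
  by rewrite -dvdn_divisors // => en ->; apply: dvdn_div.
by exists (n %/ d)%N; rewrite -?dvdn_divisors ?dvdn_div ?divn_divn.
Qed.

Lemma coprime_addMl n v j : coprime (v * n + j) n = coprime j n.
Proof. by rewrite /coprime gcdnC gcdnMDl gcdnC. Qed.

(** For [d = n / e] the binomial is a quotient of three factorials. Weighting each by its power of e
    changes nothing, since the exponents balance, and makes [prod_fact_moebius] applicable. The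
    units below [u n] then split at [v n]. *)
Lemma prod_binomial_moebius n u v : (1 < n)%N -> (v <= u)%N ->
  \prod_(d <- divisors n) ('C(u * d, v * d)%:R : rat) ^ moebius (n %/ d)
  = \prod_(0 <= j < (u - v) * n | coprime j n) ((v * n + j)%:R / j%:R).
Proof.
move=> n1 vu; have n0 := ltnW n1.
pose A m e := (((m * (n %/ e))`! * e ^ (m * (n %/ e)))%:R : rat).
have A0 m e : (e %| n)%N -> A m e != 0.
  by move=> en; rewrite pnatr_eq0 -lt0n muln_gt0 fact_gt0 expn_gt0 (dvdn_gt0 n0).
have nNcop k : coprime (k * n) n = false.
  by rewrite -[(k * n)%N]addn0 coprime_addMl /coprime gcd0n; case: eqP n1 => // ->.
(* The range 1..mn becomes 0..mn-1: both end points are multiples of n, hence not prime to n. *)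
have AE m : \prod_(e <- divisors n) A m e ^ moebius e
    = \prod_(0 <= k < m * n | coprime k n) k%:R.
  rewrite prod_fact_moebius //; have [->|m0] := posnP m; first by rewrite mul0n !big_geq.
  have mn0 : (0 < m * n)%N by rewrite muln_gt0 m0.
  rewrite [LHS]big_mkcond big_nat_recr //= nNcop mulr1 -big_mkcond.
  by rewrite [RHS]big_ltn_cond // -[X in coprime X]/(0 * n)%N nNcop.
rewrite (perm_big _ (perm_divn_divisors n0)) big_map.
transitivity (\prod_(e <- divisors n)
   (A u e ^ moebius e / (A v e ^ moebius e * A (u - v)%N e ^ moebius e))).
  rewrite big_seq [RHS]big_seq; apply: eq_bigr => e; rewrite -dvdn_divisors // => en.
  rewrite divn_divn // -expfzMl invr_expz -exprz_inv -expfzMl; congr (_ ^ _).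
  apply: canRL (mulfK _) _; first by rewrite mulf_neq0 ?A0.
  have le : (v * (n %/ e) <= u * (n %/ e))%N by rewrite leq_mul2r vu orbT.
  rewrite /A -!natrM -(bin_fact le) -mulnBl.
  have -> : (e ^ (u * (n %/ e)) = e ^ (v * (n %/ e)) * e ^ ((u - v) * (n %/ e)))%N.
    by rewrite -expnD -mulnDl subnKC.
  by rewrite !natrM; ring.
rewrite big_split prodfV big_split /= !AE.
have P0 m : \prod_(0 <= k < m * n | coprime k n) (k%:R : rat) != 0.
  rewrite prodf_seq_neq0; apply/allP => k _; apply/implyP.
  by case: k => [|k _]; rewrite ?pnatr_eq0 // -(mul0n n) nNcop.
rewrite big_split prodfV /= invfM mulrA; congr (_ / _).
apply: canLR (mulfK _) _ => //.
rewrite -[in LHS](subnKC vu) mulnDl (@big_cat_nat _ _ _ (v * n)) ?leq_addr //= mulrC.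
congr (_ * _); rewrite -{1}[(v * n)%N]add0n big_addn addKn.
by apply: eq_big => k; rewrite addnC // coprime_addMl.
Qed.

(** * The square of the quotient modulo n^4 *)

Lemma coprime_neq0 n j : (1 < n)%N -> coprime j n -> (j%:R : rat) != 0.
Proof.
by move=> n1; rewrite pnatr_eq0; apply: contraTneq => ->; rewrite /coprime gcd0n gtn_eqF.
Qed.

Lemma coprime_subMl n w j : (j <= w * n)%N -> coprime (w * n - j) n = coprime j n.
Proof.
move=> jw; have h a b : (a + b = w * n)%N -> (gcdn a n %| gcdn b n)%N.
  move=> ab; rewrite dvdn_gcd dvdn_gcdr andbT.
  by rewrite -(@dvdn_addr a) ?dvdn_gcdl // ab dvdn_mull // dvdn_gcdr.
rewrite /coprime; congr (_ == _); apply/eqP.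
by rewrite eqn_dvd !h // ?subnK ?subnKC.
Qed.

Lemma big_coprime_gt0 (R : Type) (idx : R) (op : Monoid.com_law idx) n N F : (1 < n)%N ->
  \big[op/idx]_(0 <= j < N | coprime j n) F j = \big[op/idx]_(1 <= j < N | coprime j n) F j.
Proof.
move=> n1; case: N => [|N]; first by rewrite !big_geq.
by rewrite big_ltn_cond // /coprime gcd0n gtn_eqF.
Qed.

Lemma big_coprime_rev (R : Type) (idx : R) (op : Monoid.com_law idx) n w F : (1 < n)%N ->
  \big[op/idx]_(0 <= j < w * n | coprime j n) F j
  = \big[op/idx]_(0 <= j < w * n | coprime j n) F (w * n - j)%N.
Proof.
(* The index 0 is dropped first: the reflection permutes 1..wn-1 but sends 0 to wn. *)
move=> n1; rewrite !(big_coprime_gt0 _ _ _ n1) big_nat_rev.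
rewrite big_nat_cond [RHS]big_nat_cond.
apply: eq_big => [j|j _]; last by rewrite add1n subSS.
rewrite add1n subSS; case: (ltnP j (w * n)) => jw; last by rewrite andbF.
by rewrite coprime_subMl // ltnW.
Qed.

Lemma sum_coprime_S (F : nat -> rat) n w :
  \sum_(0 <= j < w.+1 * n | coprime j n) F j =
  \sum_(0 <= j < w * n | coprime j n) F j
    + \sum_(0 <= j < n | coprime j n) F (w * n + j)%N.
Proof.
rewrite (@big_cat_nat _ _ _ (w * n)) //=; last by rewrite mulSn leq_addl.
congr (_ + _); rewrite -{1}[(w * n)%N]add0n big_addn mulSn addnK.
by apply: eq_big => j; rewrite addnC // coprime_addMl.
Qed.

Lemma prod_1D_expand n N (I : Type) (r : seq I) (P : pred I) (a : I -> rat) :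
  N \in Zloc n -> (forall i, P i -> a i \in Zloc n) ->
  exists2 z, z \in Zloc n &
    \prod_(i <- r | P i) (1 + N * a i) = 1 + N * \sum_(i <- r | P i) a i + N ^+ 2 * z.
Proof.
move=> Nn an; elim: r => [|i r [z zn IH]].
  by exists 0; rewrite ?rpred0 // !big_nil; ring.
rewrite !big_cons; case: ifP => [Pi|_]; last by exists z.
exists (a i * \sum_(j <- r | P j) a j + (1 + N * a i) * z); last by rewrite IH; ring.
rewrite rpredD ?rpredM ?rpredD ?rpredM ?rpred1 ?an //.
by rewrite rpred_sum.
Qed.

(** The cubes at j and [w n - j] cancel modulo n, so twice the sum vanishes, and 2 is invertible. *)
Lemma sum_inv3_cong0 n w : (1 < n)%N -> coprime 2 n ->
  cong n n%:R (\sum_(0 <= j < w * n | coprime j n) (j%:R^-1) ^+ 3) 0.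
Proof.
move=> n1 n2; have nR0 : (n%:R : rat) != 0 by rewrite pnatr_eq0 -lt0n ltnW.
set S := \sum_(_ <= _ < _ | _) _.
have -> : S = 2%:R^-1 * (S + S) by field.
rewrite -[X in cong _ _ _ X](mulr0 (2%:R^-1)) congMl ?Zloc_inv //.
rewrite {2}/S (big_coprime_rev _ _ _ n1) -big_split /= big_nat_cond.
rewrite /cong subr0 mulr_suml rpred_sum // => j /andP[jw jn].
have ejw : (w * n - j)%:R = w%:R * n%:R - j%:R :> rat by rewrite natrB ?natrM // ltnW.
have kn : coprime (w * n - j) n by rewrite coprime_subMl // ltnW.
have j0 := coprime_neq0 n1 jn; have := coprime_neq0 n1 kn.
have := Zloc_inv kn; rewrite ejw; have := Zloc_inv jn.
move: (j%:R : rat) j0 => x x0 xn yn y0.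
have -> : (x^-1 ^+ 3 + (w%:R * n%:R - x)^-1 ^+ 3) / n%:R
  = w%:R * (x^-1 * (w%:R * n%:R - x)^-1) * (x^-1 ^+ 2 - x^-1 * (w%:R * n%:R - x)^-1
        + (w%:R * n%:R - x)^-1 ^+ 2) by field; rewrite ?x0 ?nR0 ?y0.
by rewrite rpredM ?rpredD ?rpredN ?rpredM ?rpredX ?Zloc_nat.
Qed.

Definition sum_inv2 (n : nat) : rat := \sum_(0 <= j < n | coprime j n) (j%:R^-1) ^+ 2.

(** Each block of length n contributes H: modulo n^2, [(w n + j)^-2] is [j^-2 - 2 w n j^-3], and the
    linear terms sum to 0 by [sum_inv3_cong0]. *)
Lemma sum_inv2_cong n w : (1 < n)%N -> coprime 2 n ->
  cong n (n%:R ^+ 2) (\sum_(0 <= j < w * n | coprime j n) (j%:R^-1) ^+ 2)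
    (w%:R * sum_inv2 n).
Proof.
move=> n1 n2; have nR0 : (n%:R : rat) != 0 by rewrite pnatr_eq0 -lt0n ltnW.
elim: w => [|w IHw]; first by rewrite mul0n big_geq // mul0r cong_refl.
rewrite sum_coprime_S -natr1 mulrDl mul1r; apply: congD => //.
have := sum_inv3_cong0 1 n1 n2; rewrite mul1n => S3.
have : cong n (n%:R ^+ 2) (n%:R * (2%:R * w%:R *
    \sum_(0 <= j < n | coprime j n) (j%:R^-1) ^+ 3)) (n%:R * 0).
  rewrite expr2 cong_scale // -[X in cong _ _ _ X](mulr0 (2%:R * w%:R)).
  by rewrite congMl ?rpredM ?Zloc_nat.
rewrite mulr0 => S3'.
have {S3 S3'} : cong n (n%:R ^+ 2) (sum_inv2 n - (n%:R * (2%:R * w%:R *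
    \sum_(0 <= j < n | coprime j n) (j%:R^-1) ^+ 3))) (sum_inv2 n - 0).
  by rewrite congB ?cong_refl.
rewrite subr0; apply: cong_trans.
rewrite /sum_inv2 !mulr_sumr -sumrB; apply: cong_sum => j jn.
have kn : coprime (w * n + j) n by rewrite coprime_addMl.
have j0 := coprime_neq0 n1 jn; have := coprime_neq0 n1 kn.
have := Zloc_inv kn; have := Zloc_inv jn; rewrite natrD natrM.
have := Zloc_nat n j.
move: (j%:R : rat) j0 => x x0 xn xin yn y0.
rewrite /cong.
have -> : ((w%:R * n%:R + x)^-1 ^+ 2 - (x^-1 ^+ 2 - n%:R * (2%:R * w%:R * x^-1 ^+ 3))) / n%:R ^+ 2
  = w%:R ^+ 2 * (2%:R * (w%:R * n%:R + x) + x) * ((w%:R * n%:R + x)^-1 ^+ 2 * x^-1 ^+ 3) :> rat.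
  by field; rewrite ?x0 ?nR0 ?y0.
by zloc.
Qed.

(** Squaring allows the reflection over the full range, with [(v n + j)(v n + w n - j) = j (w n - j)
    + v (v + w) n^2]. Since the perturbation has order n^2, first-order expansion is exact modulo
    n^4. *)
Lemma coprime_quotient_sqr n v w : (1 < n)%N -> coprime 2 n ->
  cong n (n%:R ^+ 4)
    ((\prod_(0 <= j < w * n | coprime j n) ((v * n + j)%:R / j%:R)) ^+ 2)
     (1 - (v + w)%:R * v%:R * w%:R * n%:R ^+ 2 * sum_inv2 n).
Proof.
move=> n1 n2; set L := (X in X ^+ 2); have nR0 : (n%:R : rat) != 0 by rewrite pnatr_eq0 -lt0n ltnW.
pose a j : rat := (v + w)%:R * v%:R * (j%:R^-1 * (w * n - j)%:R^-1).
have an j : (j < w * n)%N && coprime j n -> a j \in Zloc n.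
  move=> /andP[jw jn]; rewrite !rpredM ?Zloc_nat ?Zloc_inv //.
  by rewrite coprime_subMl // ltnW.
have LL : L ^+ 2 = \prod_(0 <= j < w * n | (j < w * n)%N && coprime j n) (1 + n%:R ^+ 2 * a j).
  rewrite expr2 {2}/L (big_coprime_rev _ _ _ n1) -big_split /= big_nat_cond [RHS]big_nat_cond.
  apply: eq_big => [j|j]; first by case: (ltnP j).
  move=> /andP[jw jn].
  have ejw : (w * n - j)%:R = w%:R * n%:R - j%:R :> rat by rewrite natrB ?natrM // ltnW.
  have kn : coprime (w * n - j) n by rewrite coprime_subMl // ltnW.
  have j0 := coprime_neq0 n1 jn; have := coprime_neq0 n1 kn.
  rewrite /a !natrD natrM ejw => k0.
  by field; rewrite ?j0 ?k0.
have [z zn Lz] := prod_1D_expand (index_iota 0 (w * n)) (rpredX 2 (Zloc_nat n n)) an.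
rewrite {}LL Lz -exprM.
have -> : \sum_(0 <= j < w * n | (j < w * n)%N && coprime j n) a j
    = (v + w)%:R * v%:R * \sum_(0 <= j < w * n | coprime j n) (j%:R^-1 * (w * n - j)%:R^-1).
  rewrite mulr_sumr big_nat_cond [RHS]big_nat_cond; apply: eq_bigl => j.
  by case: (ltnP j).
set S := \sum_(_ <= _ < _ | _) _.
(* Modulo n^2, [1 / (j (w n - j))] is [- j^-2 - w n j^-3]; the cubic part sums to 0. *)
have S2 : cong n (n%:R ^+ 2) S (- (w%:R * sum_inv2 n)).
  have h2 := sum_inv2_cong w n1 n2.
  have h3 : cong n (n%:R ^+ 2) (n%:R * (w%:R *
    \sum_(0 <= j < w * n | coprime j n) (j%:R^-1) ^+ 3)) (n%:R * 0).
    rewrite expr2 cong_scale // -[X in cong _ _ _ X](mulr0 (w%:R)).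
    by rewrite congMl ?Zloc_nat ?sum_inv3_cong0.
  have := congB (congB (cong_refl n (n%:R ^+ 2) 0) h2) h3.
  rewrite mulr0 subr0 !sub0r; apply: cong_trans.
  rewrite !mulr_sumr -sumrN -sumrB /S big_nat_cond [X in cong _ _ _ X]big_nat_cond.
  apply: cong_sum => j /andP[jw jn].
  have ejw : (w * n - j)%:R = w%:R * n%:R - j%:R :> rat by rewrite natrB ?natrM // ltnW.
  have kn : coprime (w * n - j) n by rewrite coprime_subMl // ltnW.
  have j0 := coprime_neq0 n1 jn; have := coprime_neq0 n1 kn.
  have := Zloc_inv kn; rewrite ejw; have := Zloc_inv jn.
  move: (j%:R : rat) j0 => x x0 xn yn y0; rewrite /cong.
  have -> : (x^-1 / (w%:R * n%:R - x) - (- x^-1 ^+ 2 - n%:R * (w%:R * x^-1 ^+ 3))) / n%:R ^+ 2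
    = w%:R ^+ 2 * x^-1 ^+ 3 * (w%:R * n%:R - x)^-1 :> rat by field; rewrite ?x0 ?nR0 ?y0.
  by zloc.
have [t tn ->] := congP n _ _ (expf_neq0 2 nR0) S2.
apply/congP; first exact: expf_neq0.
exists (z + (v + w)%:R * v%:R * t); last by ring.
by zloc.
Qed.

(** * Doubling modulo n *)

(** Doubling modulo an odd n permutes 0..n-1 and preserves coprimality to n. *)
Lemma sum_coprime_double n (g : nat -> rat) : (0 < n)%N -> coprime 2 n ->
  \sum_(0 <= j < n | coprime j n) g j
  = \sum_(0 <= j < n | coprime j n) g ((2 * j) %% n)%N.
Proof.
move=> n0 n2; pose h (j : 'I_n) := Ordinal (ltn_pmod (2 * j) n0).
rewrite !big_mkord (reindex_inj (h := h)); last first.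
  move=> i j /(congr1 val) /= /eqP.
  wlog ij : i j / (i <= j)%N => [hw|].
    by have [/hw//|/ltnW/hw ji] := leqP i j; rewrite eq_sym => /ji.
  rewrite eq_sym eqn_mod_dvd ?leq_mul2l // -mulnBr Gauss_dvdr 1?coprime_sym // => nij.
  apply/val_inj/eqP; rewrite /= eqn_leq ij -subn_eq0 /=; move: nij.
  case: (j - i)%N (leq_ltn_trans (leq_subr i j) (ltn_ord j)) => // k kn.
  by move=> /dvdn_leq-/(_ isT); rewrite leqNgt kn.
by apply: eq_bigl => j /=; rewrite coprime_modl coprimeMl n2.
Qed.

(** The number [c_j] of the overview, equal to 0 or 1 when j < n. *)
Definition double_carry (n j : nat) : rat := ((2 * j) %/ n)%:R.

Lemma double_modE n j : ((2 * j) %% n)%:R = 2%:R * j%:R + n%:R * - double_carry n j :> rat.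
Proof.
have /(congr1 (fun m => m%:R : rat)) := divn_eq (2 * j) n.
by rewrite natrD !natrM => ->; rewrite /double_carry; ring.
Qed.

(** Reindexing by doubling replaces [j^-2] by [(2 j - n c_j)^-2], which is [(j^-2 + n c_j j^-3) / 4]
    modulo n^2. Multiplying by 4 and subtracting H leaves 3 H. *)
Lemma sum_inv2_double n : (1 < n)%N -> coprime 2 n ->
  cong n (n%:R ^+ 2) (3%:R * sum_inv2 n)
    (n%:R * \sum_(0 <= j < n | coprime j n) double_carry n j * (j%:R^-1) ^+ 3).
Proof.
move=> n1 n2; have n0 := ltnW n1.
have nR0 : (n%:R : rat) != 0 by rewrite pnatr_eq0 -lt0n.
set E := \sum_(_ <= _ < _ | _) _.
have h : cong n (n%:R ^+ 2) (4%:R * sum_inv2 n) (4%:R * (4%:R^-1 * (sum_inv2 n + n%:R * E))).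
  rewrite congMl ?Zloc_nat // {1}/sum_inv2 sum_coprime_double //.
  rewrite /sum_inv2 /E mulr_sumr -big_split mulr_sumr; apply: cong_sum => j jn /=.
  have kn : coprime ((2 * j) %% n) n by rewrite coprime_modl coprimeMl n2.
  have j0 := coprime_neq0 n1 jn; have := coprime_neq0 n1 kn.
  have := Zloc_inv kn; have := Zloc_inv jn; rewrite double_modE.
  have cn : double_carry n j \in Zloc n by exact: Zloc_nat.
  have := Zloc_nat n j; move: (j%:R : rat) j0 => x x0 xn xin yn y0; rewrite /cong.
  have -> : ((2%:R * x + n%:R * - double_carry n j)^-1 ^+ 2 -
      4%:R^-1 * (x^-1 ^+ 2 + n%:R * (double_carry n j * x^-1 ^+ 3))) / n%:R ^+ 2 =
      (2%:R^-1) ^+ 2 * (double_carry n j ^+ 2 * (3%:R * x - n%:R * double_carry n j)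
        * x^-1 ^+ 3 * (2%:R * x + n%:R * - double_carry n j)^-1 ^+ 2).
    by field; rewrite ?x0 ?nR0 ?y0.
  by have n2i := Zloc_inv n2; zloc.
have := congB h (cong_refl n (n%:R ^+ 2) (sum_inv2 n)).
have -> : 4%:R * sum_inv2 n - sum_inv2 n = 3%:R * sum_inv2 n by ring.
by have -> : 4%:R * (4%:R^-1 * (sum_inv2 n + n%:R * E)) - sum_inv2 n = n%:R * E by field.
Qed.

(** * Bernoulli numbers and power sums *)

Lemma bin_mul_exchange m k l : (k + l <= m)%N ->
  ('C(m, k) * 'C(m - k, l) = 'C(m, l) * 'C(m - l, k))%N.
Proof.
move=> klm; have km : (k <= m)%N by apply: leq_trans klm; rewrite leq_addr.
have lm : (l <= m)%N by apply: leq_trans klm; rewrite leq_addl.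
have lmk : (l <= m - k)%N by rewrite leq_subRL.
have kml : (k <= m - l)%N by rewrite leq_subRL // addnC.
have f0 : (0 < k`! * l`! * (m - k - l)`!)%N by rewrite !muln_gt0 !fact_gt0.
apply/eqP; rewrite -(eqn_pmul2r f0); apply/eqP.
transitivity m`!.
  by rewrite -(bin_fact km) -(bin_fact lmk); ring.
by rewrite -(bin_fact lm) -(bin_fact kml) subnAC; ring.
Qed.

(** In terms of Bernoulli polynomials this is [(B_{s+1}(x) - B_{s+1}) / (s + 1)]. *)
Definition faulhaber (s : nat) (x : rat) : rat :=
  s.+1%:R^-1 * \sum_(k < s.+1) 'C(s.+1, k)%:R * bernoulli_number k * x ^+ (s.+1 - k).

Lemma sum_bernoulli_number_lt m : (0 < m)%N ->
  \sum_(k < m) 'C(m, k)%:R * bernoulli_number k = (m == 1%N)%:R.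
Proof.
case: m => [|[|m]] // _; last exact: sum_bernoulli_number.
by rewrite big_ord1 bin0 mul1r bernoulli_number0.
Qed.

(** With [m = s + 1], the coefficient of [x^l] is [C(m, l)] times the sum of [C(m - l, k) B_k] over
    k < m - l. The Bernoulli recurrence kills it unless [m - l = 1]. *)
Lemma faulhaber_diff s x : faulhaber s (x + 1) - faulhaber s x = x ^+ s.
Proof.
rewrite /faulhaber -mulrBr -sumrB.
set m := s.+1; have m0 : (m%:R : rat) != 0 by rewrite pnatr_eq0.
apply: (canLR (mulKf m0)).
transitivity (\sum_(k < m) \sum_(l < m | (k + l < m)%N)
    'C(m, l)%:R * x ^+ l * ('C(m - l, k)%:R * bernoulli_number k)).
  apply: eq_bigr => k _; rewrite -mulrBr [x + 1]addrC exprDn big_ord_recr /= subnn expr0 mul1r.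
  rewrite binn mulr1n addrK (big_ord_widen m
    (fun l => (1 ^+ (m - k - l) * x ^+ l) *+ 'C(m - k, l))); last exact: leq_subr.
  rewrite mulr_sumr; apply: eq_big => [l|l lmk]; first by rewrite ltn_subRL.
  have klm : (k + l <= m)%N by rewrite ltnW // -ltn_subRL.
  have := congr1 (fun a => a%:R : rat) (bin_mul_exchange klm).
  rewrite !natrM => e; rewrite expr1n mul1r -[_ ^+ l *+ _]mulr_natr.
  transitivity ('C(m, k)%:R * 'C(m - k, l)%:R * (bernoulli_number k * x ^+ l)); first by ring.
  by rewrite e; ring.
rewrite (exchange_big_dep xpredT) //=.
transitivity (\sum_(l < m) 'C(m, l)%:R * x ^+ l * ((l : nat) == s)%:R).
  apply: eq_bigr => l _; rewrite -mulr_sumr; congr (_ * _).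
  have -> : ((l : nat) == s) = (m - l == 1)%N.
    by have := ltn_ord l; rewrite /m; lia.
  rewrite -sum_bernoulli_number_lt ?subn_gt0 //.
  rewrite (big_ord_widen m (fun k => 'C(m - l, k)%:R * bernoulli_number k)); last exact: leq_subr.
  by apply: eq_bigl => k; rewrite ltn_subRL addnC.
rewrite big_ord_recr big1 /= ?add0r => [|l _]; last by rewrite ltn_eqF ?mulr0.
by rewrite eqxx mulr1 binSn.
Qed.

Lemma faulhaber0 s : faulhaber s 0 = 0.
Proof.
rewrite /faulhaber big1 ?mulr0 // => k _.
by rewrite expr0n subn_eq0 leqNgt ltn_ord mulr0.
Qed.

Lemma faulhaber_nat s N : faulhaber s N%:R = \sum_(0 <= i < N) i%:R ^+ s.
Proof.
elim: N => [|N IHN]; first by rewrite faulhaber0 big_geq.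
by rewrite big_nat_recr //= -IHN -(faulhaber_diff s N%:R) natr1 addrC subrK.
Qed.

(** The difference equation is run backwards from 0. This symmetry later removes the Bernoulli
    numbers of odd index without showing that they vanish. *)
Lemma faulhaberN s N : (0 < s)%N -> ~~ odd s ->
  faulhaber s (- N%:R) = - faulhaber s N%:R - N%:R ^+ s.
Proof.
move=> s0 sev; elim: N => [|N IHN].
  by rewrite oppr0 faulhaber0 expr0n gtn_eqF // subr0 oppr0.
have e1 := faulhaber_diff s (- N.+1%:R); have e2 := faulhaber_diff s N%:R.
have e3 : - N.+1%:R + 1 = - N%:R :> rat by rewrite -natr1; ring.
move: e1 e2; rewrite e3 natr1 IHN exprNn -signr_odd (negPf sev) expr0 mul1r => <-.
by move: (N%:R ^+ s) => y <-; ring.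
Qed.

(** * Bounds on denominators at the primes dividing n *)

Lemma Zloc_expn_div n c m : (0 < m)%N -> (0 < n)%N ->
  (forall p, prime p -> (p %| n)%N -> (logn p m <= c)%N) ->
  (n%:R ^+ c / m%:R : rat) \in Zloc n.
Proof.
move=> m0 n0 lm; set g := gcdn m (n ^ c).
have gm : (g %| m)%N := dvdn_gcdl _ _; have gn : (g %| n ^ c)%N := dvdn_gcdr _ _.
have g0 : (0 < g)%N by rewrite gcdn_gt0 m0.
(* For every prime p dividing n, the valuation bound puts the whole p-part of m into g, so [m / g]
   is prime to n. *)
apply/ZlocP; exists (m %/ g)%N; last first.
  have -> : (m %/ g)%:R * (n%:R ^+ c / m%:R) = (n ^ c %/ g)%:R :> rat.
    rewrite -natrX -{2}(divnK gm) -{1}(divnK gn) !natrM.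
    by field; rewrite !pnatr_eq0 -!lt0n g0 divn_gt0 // dvdn_leq.
  exact: natr_int.
have d0 : (0 < m %/ g)%N by rewrite divn_gt0 // dvdn_leq.
rewrite coprime_has_primes //; apply/hasPn => p.
rewrite mem_primes => /and3P[pp _ pn]; rewrite mem_primes pp d0 /=.
have pg : (p ^ logn p m %| g)%N.
  rewrite dvdn_gcd pfactor_dvdnn /=.
  by apply: dvdn_trans (dvdn_exp2l _ (lm p pp pn)) _; rewrite dvdn_exp2r.
apply/negP => pd; have : (p ^ (logn p m).+1 %| m)%N.
  by rewrite expnS -{2}(divnK gm) dvdn_mul.
by rewrite pfactor_dvdn // ltnn.
Qed.

Lemma coprime6_dvd n p : coprime n 6 -> prime p -> (p %| n)%N -> (4 < p)%N.
Proof.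
move=> n6 pp pn; have : coprime p 6 by apply: coprime_dvdl n6.
by case: p pp {pn} => [|[|[|[|[|]]]]].
Qed.

(** A prime p dividing n is at least 5 and divides at most one of i and i + 1. Its exponent there is
    at most i - 2 because [i + 1 < 5^(i - 1)]. *)
Lemma Zloc_expn_div_consecutive n i : (0 < n)%N -> coprime n 6 -> (1 < i)%N ->
  (n%:R ^+ (i - 2) / (i * i.+1)%:R : rat) \in Zloc n.
Proof.
move=> n0 n6 i1; have i0 := ltnW i1.
apply: Zloc_expn_div => // [|p pp pn]; first by rewrite muln_gt0 i0.
have p5 := coprime6_dvd n6 pp pn.
have lt5 : (i.+1 < 5 ^ (i - 1))%N.
  case: i i1 {i0} => [|[|i]] // _; rewrite subSS subn0.
  by elim: i => // i IHi; rewrite expnS; lia.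
have hk k : (0 < k <= i.+1)%N -> (logn p k <= i - 2)%N.
  case/andP=> k0 ki; rewrite leqNgt; apply/negP => h.
  have : (5 ^ (i - 1) <= k)%N.
    apply: leq_trans (dvdn_leq k0 (pfactor_dvdnn p k)).
    apply: (@leq_trans (p ^ (i - 1))); first by rewrite leq_exp2r // subn_gt0.
    by rewrite leq_exp2l ?prime_gt1 //; lia.
  by rewrite leqNgt => /negP; apply; apply: leq_ltn_trans lt5.
rewrite lognM //; have [pi|pNi] := boolP (p %| i)%N.
  rewrite [logn p i.+1]logn_coprime ?addn0 ?hk ?i0 ?leqnSn //.
  by rewrite prime_coprime // -addn1 dvdn_addr // dvdn1 neq_ltn prime_gt1 ?orbT.
by rewrite [logn p i]logn_coprime ?prime_coprime // add0n hk ?leqnn.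
Qed.

Lemma Zloc_sum n (I : Type) (r : seq I) (P : pred I) (F : I -> rat) :
  (forall i, P i -> F i \in Zloc n) -> \sum_(i <- r | P i) F i \in Zloc n.
Proof. exact: rpred_sum. Qed.

(** Trades the denominator s + 1 for s - k + 1, which the accompanying power of n can absorb. *)
Lemma bin_div_succ s k : (k <= s)%N ->
  s.+1%:R^-1 * 'C(s.+1, k)%:R = 'C(s, s - k)%:R / (s - k).+1%:R :> rat.
Proof.
move=> ks; have := congr1 (fun a => a%:R : rat) (mul_bin_diag s.+1 (s - k)).
rewrite /= -subSn // (bin_sub (leqW ks)) !natrM subSn // => e.
apply: (canLR (mulKf _)); first by rewrite pnatr_eq0.
by rewrite mulrA; apply: (canRL (mulfK _)); rewrite ?pnatr_eq0 // mulrC e.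
Qed.

(** Exhibits the factor s required by congruences modulo [s n^2]. *)
Lemma bin_div_pred s i : (0 < i)%N -> (0 < s)%N ->
  'C(s, i)%:R = s%:R * ('C(s.-1, i.-1)%:R / i%:R) :> rat.
Proof.
move=> i0 s0; have := congr1 (fun a => a%:R : rat) (mul_bin_diag s i.-1).
rewrite prednK // !natrM mulrA => ->.
by rewrite mulrAC divff ?mul1r // pnatr_eq0 -lt0n.
Qed.

Lemma Zloc_expn_div_succ n i : (0 < n)%N -> coprime n 6 -> (0 < i)%N ->
  (n%:R ^+ i / i.+1%:R : rat) \in Zloc n.
Proof.
move=> n0 n6; case: i => [|[|i]] // _.
  by rewrite ZlocM ?ZlocX ?Zloc_nat ?Zloc_inv // coprime_sym (coprime_dvdr _ n6).
have -> : n%:R ^+ i.+2 / i.+3%:R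
    = i.+2%:R * n%:R ^+ 2 * (n%:R ^+ (i.+2 - 2) / (i.+2 * i.+3)%:R) :> rat.
  have a0 : (i.+2%:R : rat) != 0 by rewrite pnatr_eq0.
  have b0 : (i.+3%:R : rat) != 0 by rewrite pnatr_eq0.
  rewrite subn2 /= natrM !exprS; move: (i.+2%:R : rat) (i.+3%:R : rat) a0 b0 => a b a0 b0.
  by field; rewrite ?a0 ?b0.
have := Zloc_expn_div_consecutive n0 n6 (isT : 1 < i.+2)%N.
by move=> h; apply: ZlocM => //; zloc.
Qed.

(** A weak von Staudt-Clausen theorem, by strong induction: [faulhaber k n] is an integer whose top
    term is [n B_k], and the lower terms combine [n B_j] with [n^i / (i + 1)]. *)
Lemma Zloc_bernoulli n k : (0 < n)%N -> coprime n 6 ->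
  n%:R * bernoulli_number k \in Zloc n.
Proof.
move=> n0 n6; have [m] := ubnP k; elim: m k => // m IHm k /ltnSE km.
have -> : n%:R * bernoulli_number k = faulhaber k n%:R
   - \sum_(j < k) 'C(k, k - j)%:R * (n%:R * bernoulli_number j)
         * (n%:R ^+ (k - j) / (k - j).+1%:R).
  rewrite /faulhaber big_ord_recr mulrDr /= binSn subSnn expr1.
  rewrite mulr_sumr [X in X + _ - _](_ : _ = \sum_(j < k) 'C(k, k - j)%:R
      * (n%:R * bernoulli_number j) * (n%:R ^+ (k - j) / (k - j).+1%:R)); last first.
    apply: eq_bigr => j _; rewrite !mulrA bin_div_succ; last exact: ltnW.
    by rewrite (subSn (ltnW (ltn_ord j))) exprS; ring.
  by rewrite addrAC subrr add0r !mulrA mulVf ?pnatr_eq0 // mul1r mulrC.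
apply: rpredB; first by rewrite faulhaber_nat; apply: Zloc_sum => i _; zloc.
apply: Zloc_sum => j _; apply: ZlocM.
  by apply: ZlocM (Zloc_nat _ _) (IHm _ _); apply: leq_trans km.
by apply: Zloc_expn_div_succ; rewrite ?subn_gt0.
Qed.

(* The factor (1 + (-1)^(s-k)) / 2 removes the terms with s - k odd, which cancel
   in f(x) - f(-x) for f = faulhaber s. *)
Definition faulhaber_rem (s : nat) (x : rat) : rat :=
  \sum_(k < s) 2%:R^-1 * (1 + (-1) ^+ (s - k)) * 'C(s.-1, (s - k).-1)%:R
     / ((s - k) * (s - k).+1)%:R * bernoulli_number k * x ^+ (s - k).+1.

(** By [faulhaberN] the left side is the odd part of [faulhaber s] plus [N^s / 2]. In the odd part,
    k = s gives [N B_s], and the two binomial identities extract s from the other terms. *)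
Lemma faulhaber_even s N : (0 < s)%N -> ~~ odd s ->
  faulhaber s N%:R + N%:R ^+ s
  = N%:R * bernoulli_number s + 2%:R^-1 * N%:R ^+ s + s%:R * faulhaber_rem s N%:R.
Proof.
move=> s0 sev; set x : rat := N%:R.
have -> : faulhaber s x + x ^+ s
    = 2%:R^-1 * (faulhaber s x - faulhaber s (- x)) + 2%:R^-1 * x ^+ s.
  by rewrite faulhaberN // -/x; field.
rewrite addrAC; congr (_ + _).
rewrite /faulhaber -mulrBr -sumrB big_ord_recr /= mulrDr mulrDr addrC binSn subSnn !expr1.
congr (_ + _); last first.
  have s1 : (s.+1%:R : rat) != 0 by rewrite pnatr_eq0.
  by move: (s.+1%:R : rat) s1 => t t0; field.
rewrite /faulhaber_rem !mulr_sumr; apply: eq_bigr => k _.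
rewrite -mulrBr 2![s.+1%:R^-1 * (_ * _)]mulrA bin_div_succ; last exact: ltnW.
rewrite bin_div_pred ?subn_gt0 // (subSn (ltnW (ltn_ord k))) !exprS [(- x) ^+ _]exprNn natrM.
have a0 : ((s - k)%:R : rat) != 0 by rewrite pnatr_eq0 -lt0n subn_gt0.
have b0 : ((s - k).+1%:R : rat) != 0 by rewrite pnatr_eq0.
move: ((s - k)%:R : rat) ((s - k).+1%:R : rat) a0 b0 => a b a0 b0.
by field; rewrite ?a0 ?b0.
Qed.

(** * Power sums over the residues prime to n *)

Definition coprime_power_sum (n s : nat) : rat := \sum_(0 <= j < n | coprime j n) j%:R ^+ s.

(** Moebius inversion over the range 1..n: the multiples of e there are [e i] with 1 <= i <= n / e,
    and the inclusive end accounts for the extra [(n / e)^s]. *)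
Lemma coprime_power_sum_moebius n s : (1 < n)%N -> (0 < s)%N ->
  coprime_power_sum n s = \sum_(e <- divisors n) (moebius e)%:~R *
     (e%:R ^+ s * (faulhaber s (n %/ e)%:R + (n %/ e)%:R ^+ s)).
Proof.
move=> n1 s0; have n0 := ltnW n1.
have -> : coprime_power_sum n s = \sum_(1 <= j < n.+1) (coprime j n)%:R * j%:R ^+ s.
  rewrite /coprime_power_sum big_coprime_gt0 // big_mkcond big_nat_recr //=.
  have -> : coprime n n = false by rewrite /coprime gcdnn gtn_eqF.
  rewrite mul0r addr0; apply: eq_bigr => j _.
  by case: coprime; rewrite ?mul1r ?mul0r.
transitivity (\sum_(1 <= j < n.+1) \sum_(e <- divisors n | (e %| j)%N)
    ((moebius e)%:~R * j%:R ^+ s : rat)).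
  apply: eq_bigr => j _; rewrite -mulr_suml; congr (_ * _).
  by rewrite -rmorph_sum /= sum_moebius_coprime //; case: coprime.
rewrite (exchange_big_dep xpredT) //= big_seq [RHS]big_seq; apply: eq_bigr => e.
rewrite -dvdn_divisors // => en; rewrite -mulr_sumr; congr (_ * _).
have e0 : (0 < e)%N by apply: dvdn_gt0 en.
rewrite -{1}(divnK en) (big_multiples _ _ (fun j => j%:R ^+ s)) //.
rewrite faulhaber_nat -big_nat_recr //= [X in _ = _ * X]big_ltn // expr0n gtn_eqF // add0r.
by rewrite mulr_sumr; apply: eq_bigr => i _; rewrite natrM exprMn mulrC.
Qed.

(** Put [i = s - k]. The factor [e^s (n / e)^(i + 1) B_k] is divisible by [n^i], and the remaining
    [n^(i - 2) / (i (i + 1))] is integral. *)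
Lemma faulhaber_rem_cong n s e : (1 < n)%N -> coprime n 6 -> (e %| n)%N ->
  e%:R ^+ s * faulhaber_rem s (n %/ e)%:R / n%:R ^+ 2 \in Zloc n.
Proof.
move=> n1 n6 en; have n0 := ltnW n1; have e0 : (0 < e)%N by apply: dvdn_gt0 en.
have nR0 : (n%:R : rat) != 0 by rewrite pnatr_eq0 -lt0n.
have n2 : coprime 2 n by rewrite coprime_sym (coprime_dvdr _ n6).
have n2i := Zloc_inv n2.
rewrite /faulhaber_rem mulr_sumr mulr_suml; apply: Zloc_sum => k _.
(* At i = 1 the exponent i - 2 would be negative, but the parity factor is 0. *)
have ks := ltn_ord k; have [i1|i1] := leqP (s - k) 1.
  have -> : (s - k = 1)%N by move: ks i1; lia.
  by rewrite expr1 subrr !(mulr0, mul0r) rpred0.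
have hB : e%:R ^+ s * (bernoulli_number k * (n %/ e)%:R ^+ (s - k).+1)
    / n%:R ^+ (s - k) \in Zloc n.
  (* The splitting [s = (i + 1) + (k - 1)] needs k > 0; for k = 0, [B_0 = 1] makes the claim
     direct. *)
  have [k0|k0] := posnP (k : nat).
    rewrite k0 subn0 bernoulli_number0 mul1r [_ ^+ s.+1]exprSr mulrA -exprMn -natrM mulnC divnK //.
    by rewrite mulrAC divff ?mul1r ?expf_neq0 ?Zloc_nat.
  have -> : e%:R ^+ s = e%:R ^+ ((s - k).+1 + k.-1) :> rat.
    by congr (_ ^+ _); move: ks k0; lia.
  have -> : e%:R ^+ ((s - k).+1 + k.-1) * (bernoulli_number k * (n %/ e)%:R ^+ (s - k).+1)
      / n%:R ^+ (s - k) = e%:R ^+ k.-1 * (n%:R * bernoulli_number k).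
    have nE : (n%:R : rat) = (n %/ e)%:R * e%:R by rewrite -natrM divnK.
    have h1 : ((n %/ e)%:R : rat) ^+ (s - k) != 0.
      by rewrite expf_neq0 // pnatr_eq0 -lt0n divn_gt0 // dvdn_leq.
    have h2 : (e%:R : rat) ^+ (s - k) != 0 by rewrite expf_neq0 // pnatr_eq0 -lt0n.
    rewrite nE exprMn exprD !exprS.
    move: (_ ^+ _ : rat) (_ ^+ _ : rat) h1 h2 => q c q0 c0.
    by field; rewrite ?q0 ?c0.
  by apply: ZlocM; [zloc | apply: Zloc_bernoulli].
have hD := Zloc_expn_div_consecutive n0 n6 i1.
set i := (s - k)%N in i1 hB hD *.
have -> : e%:R ^+ s * (2%:R^-1 * (1 + (-1) ^+ i) * 'C(s.-1, i.-1)%:R / (i * i.+1)%:R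
     * bernoulli_number k * (n %/ e)%:R ^+ i.+1) / n%:R ^+ 2
  = 2%:R^-1 * (1 + (-1) ^+ i) * 'C(s.-1, i.-1)%:R * (n%:R ^+ (i - 2) / (i * i.+1)%:R)
    * (e%:R ^+ s * (bernoulli_number k * (n %/ e)%:R ^+ i.+1) / n%:R ^+ i).
  have -> : n%:R ^+ i = n%:R ^+ (i - 2) * n%:R ^+ 2 :> rat by rewrite -exprD subnK.
  have : (n%:R : rat) ^+ (i - 2) != 0 by rewrite expf_neq0.
  have : (n%:R : rat) ^+ 2 != 0 by rewrite expf_neq0.
  have : ((i * i.+1)%:R : rat) != 0 by rewrite pnatr_eq0 -lt0n muln_gt0 ltnW.
  move: ((i * i.+1)%:R : rat) (n%:R ^+ 2 : rat) (n%:R ^+ (i - 2) : rat) => a b c a0 b0 c0.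
  by field; rewrite ?a0 ?b0 ?c0.
by apply: ZlocM hB; apply: ZlocM hD; zloc.
Qed.

(** After Moebius inversion and [faulhaber_even], the terms [(n / e) B_s] produce the Euler product,
    the terms [(n / e)^s / 2] cancel because the Moebius sum over n > 1 is 0, and the rest is
    divisible by [s n^2]. *)
Lemma coprime_power_sum_bernoulli n s : (1 < n)%N -> coprime n 6 -> (0 < s)%N -> ~~ odd s ->
  cong n (s%:R * n%:R ^+ 2) (coprime_power_sum n s) (n%:R * bernoulli_triv_char s n).
Proof.
move=> n1 n6 s0 sev; have n0 := ltnW n1.
have sR0 : (s%:R : rat) != 0 by rewrite pnatr_eq0 -lt0n.
have nR0 : (n%:R : rat) != 0 by rewrite pnatr_eq0 -lt0n.
have -> : n%:R * bernoulli_triv_char s n = \sum_(e <- divisors n)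
    (moebius e)%:~R * (e%:R ^+ s * ((n %/ e)%:R * bernoulli_number s)).
  rewrite /bernoulli_triv_char.
  have -> : \prod_(p <- primes n) (1 - p%:R ^ (s%:Z - 1))
      = \prod_(p <- primes n) (1 - p%:R ^+ s.-1) :> rat.
    by have -> : s%:Z - 1 = s.-1%:Z by move: s0; lia.
  rewrite -(@sum_moebius_mulf n (fun e => e%:R ^+ s.-1)) ?expr1n // => [|a b _ _]; last first.
    by rewrite natrM exprMn.
  rewrite mulrA mulr_sumr big_seq [RHS]big_seq; apply: eq_bigr => e.
  rewrite -dvdn_divisors // => en.
  have -> : (n%:R : rat) = (n %/ e)%:R * e%:R by rewrite -natrM divnK.
  have -> : e%:R ^+ s = e%:R * e%:R ^+ s.-1 :> rat by rewrite -exprS prednK.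
  by ring.
have half0 : \sum_(e <- divisors n) (moebius e)%:~R *
    (e%:R ^+ s * (2%:R^-1 * (n %/ e)%:R ^+ s)) = 0 :> rat.
  transitivity (\sum_(e <- divisors n) (moebius e)%:~R * (2%:R^-1 * n%:R ^+ s) : rat).
    rewrite big_seq [RHS]big_seq; apply: eq_bigr => e; rewrite -dvdn_divisors // => en.
    have -> : (n%:R : rat) = (n %/ e)%:R * e%:R by rewrite -natrM divnK.
    by rewrite exprMn; ring.
  by rewrite -mulr_suml -rmorph_sum /= sum_moebius // gtn_eqF // mul0r.
rewrite coprime_power_sum_moebius // /cong -sumrB -[\sum_(_ <- _) _]subr0.
rewrite -[X in _ - X]half0 -sumrB mulr_suml.
rewrite big_seq; apply: Zloc_sum => e; rewrite -dvdn_divisors // => en.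
rewrite faulhaber_even //.
have := faulhaber_rem_cong s n1 n6 en.
set R := faulhaber_rem _ _ => h.
have -> : ((moebius e)%:~R * (e%:R ^+ s * ((n %/ e)%:R * bernoulli_number s +
    2%:R^-1 * (n %/ e)%:R ^+ s + s%:R * R)) -
   (moebius e)%:~R * (e%:R ^+ s * ((n %/ e)%:R * bernoulli_number s)) -
   (moebius e)%:~R * (e%:R ^+ s * (2%:R^-1 * (n %/ e)%:R ^+ s))) / (s%:R * n%:R ^+ 2)
   = (moebius e)%:~R * (e%:R ^+ s * R / n%:R ^+ 2).
  by move: (e%:R ^+ s : rat) ((n %/ e)%:R ^+ s : rat) => x y; field; rewrite ?sR0 ?nR0.
by apply: ZlocM h; apply: Zloc_int.
Qed.

(** * Kummer congruence from doubling *)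

(** A prime factor p is odd and at least 5, so p - 1 is even and at least 4. This makes
    [s = phi(n) - 2] positive and even. *)
Lemma totient_coprime6 n : (1 < n)%N -> coprime n 6 -> (3 < totient n)%N && ~~ odd (totient n).
Proof.
move=> n1 n6; have n0 := ltnW n1; have [p pp pn] := pdivP n1.
have p5 := coprime6_dvd n6 pp pn.
have [m pm ->] := pfactor_coprime pp n0.
have a0 : (0 < logn p n)%N by rewrite logn_gt0 mem_primes pp n0.
have podd : odd p by apply: contraTT p5 => /(prime_oddPn pp)->.
rewrite totient_coprime ?coprimeXr 1?coprime_sym // totient_pfactor // !oddM.
have -> : odd p.-1 = false by rewrite -subn1 oddB ?prime_gt0 // podd.
have m0 : (0 < m)%N by case: m pm => //; rewrite prime_coprime // dvdn0.
rewrite andbF andbT; apply: (@leq_mul 1 (4 * 1)); first by rewrite totient_gt0.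
by apply: leq_mul; [rewrite ltn_predRL | rewrite expn_gt0 prime_gt0].
Qed.

(* Modulo s n^2, and not merely n^2: dividing by s has to preserve the congruence. *)
Lemma exprD_cong n s a b : (0 < n)%N -> coprime n 6 -> (0 < s)%N ->
  a \in Zloc n -> b \in Zloc n ->
  cong n (s%:R * n%:R ^+ 2) ((a + n%:R * b) ^+ s) (a ^+ s + s%:R * n%:R * (b * a ^+ s.-1)).
Proof.
move=> n0 n6; case: s => // s _ an bn.
have nR0 : (n%:R : rat) != 0 by rewrite pnatr_eq0 -lt0n.
have sR0 : (s.+1%:R : rat) != 0 by rewrite pnatr_eq0.
rewrite exprDn big_ord_recl big_ord_recl /= /bump /= !subn0.
rewrite !expr0 bin0 bin1 mulr1 mulr1n subSS subn0.
rewrite /cong.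
have -> : forall S, (a ^+ s.+1 + (a ^+ s * (n%:R * b) ^+ 1 *+ s.+1 + S) -
   (a ^+ s.+1 + s.+1%:R * n%:R * (b * a ^+ s))) = S.
  by move=> S; rewrite expr1 -mulr_natr; ring.
rewrite mulr_suml; apply: Zloc_sum => i _.
(* From the quadratic term on, [C(s, i) = s C(s - 1, i - 1) / i], and [n^(i - 2) / i] is
   integral. *)
rewrite !add1n -mulr_natr bin_div_pred // exprMn /=.
have -> : n%:R ^+ i.+2 = n%:R ^+ 2 * n%:R ^+ (i.+2 - 2) :> rat by rewrite -exprD subnKC.
have hD := Zloc_expn_div_consecutive n0 n6 (isT : 1 < i.+2)%N.
have i0 : (i.+2%:R : rat) != 0 by rewrite pnatr_eq0.
have i1 : (i.+3%:R : rat) != 0 by rewrite pnatr_eq0.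
have {}hD : n%:R ^+ (i.+2 - 2) / i.+2%:R \in Zloc n.
  have -> : n%:R ^+ (i.+2 - 2) / i.+2%:R
      = i.+3%:R * (n%:R ^+ (i.+2 - 2) / (i.+2 * i.+3)%:R) :> rat.
    rewrite natrM; move: (i.+2%:R : rat) (i.+3%:R : rat) i0 i1 => x y x0 y0.
    by field; rewrite ?x0 ?y0.
  by apply: ZlocM hD; apply: Zloc_nat.
have -> : a ^+ (s.+1 - i.+2) * (n%:R ^+ 2 * n%:R ^+ (i.+2 - 2) * b ^+ i.+2) *
      (s.+1%:R * ('C(s, i.+1)%:R / i.+2%:R)) / (s.+1%:R * n%:R ^+ 2)
  = a ^+ (s.+1 - i.+2) * b ^+ i.+2 * 'C(s, i.+1)%:R * (n%:R ^+ (i.+2 - 2) / i.+2%:R) :> rat.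
  move: (i.+2%:R : rat) (s.+1%:R : rat) i0 sR0 => x y x0 y0.
  move: (n%:R ^+ (i.+2 - 2) : rat) (b ^+ i.+2) => c d.
  by field; rewrite ?x0 ?y0 ?nR0.
by apply: ZlocM hD; zloc.
Qed.

Lemma coprime_power_sum_double n s : (0 < n)%N -> coprime n 6 -> (0 < s)%N ->
  cong n (s%:R * n%:R ^+ 2) (coprime_power_sum n s)
    (2%:R ^+ s * coprime_power_sum n s - s%:R * n%:R * 2%:R ^+ s.-1 *
       \sum_(0 <= j < n | coprime j n) double_carry n j * j%:R ^+ s.-1).
Proof.
move=> n0 n6 s0; have n2 : coprime 2 n by rewrite coprime_sym (coprime_dvdr _ n6).
rewrite {1}/coprime_power_sum sum_coprime_double //.
rewrite /coprime_power_sum !mulr_sumr -sumrB; apply: cong_sum => j jn.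
rewrite double_modE.
have -> : 2%:R ^+ s * j%:R ^+ s - s%:R * n%:R * 2%:R ^+ s.-1 * (double_carry n j * j%:R ^+ s.-1)
  = (2%:R * j%:R) ^+ s + s%:R * n%:R * (- double_carry n j * (2%:R * j%:R) ^+ s.-1) :> rat.
  by rewrite !exprMn; ring.
by apply: exprD_cong => //; rewrite /double_carry; zloc.
Qed.

Lemma expn_totient_cong n j : (0 < n)%N -> coprime j n ->
  exists2 t, t \in Zloc n & (j%:R : rat) ^+ totient n = 1 + n%:R * t.
Proof.
move=> n0 jn; apply/(@congP _ n%:R); first by rewrite pnatr_eq0 -lt0n.
have /eqP := Euler_exp_totient jn.
have [->|j0] := posnP j.
  rewrite exp0n ?totient_gt0 // eq_sym eqn_mod_dvd // subn0 dvdn1 => /eqP->.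
  by rewrite /cong invr1 mulr1 rpredB ?Zloc_nat // rpredX // rpred0.
rewrite eqn_mod_dvd ?expn_gt0 ?j0 // => /dvdnP[c cE].
rewrite /cong -natrX -(@natrB _ _ 1) ?expn_gt0 ?j0 // cE natrM mulfK ?Zloc_nat //.
by rewrite pnatr_eq0 -lt0n.
Qed.

Lemma sum_inv2_bernoulli n (X := bernoulli_triv_char (totient n - 2) n / (totient n - 2)%:R) :
  (1 < n)%N -> coprime n 6 ->
  X \in Zloc n /\ cong n (n%:R ^+ 2) (sum_inv2 n) (- (2%:R * n%:R * X)).
Proof.
move=> n1 n6; have n0 := ltnW n1.
have n2 : coprime 2 n by rewrite coprime_sym (coprime_dvdr _ n6).
have n3 : coprime 3 n by rewrite coprime_sym (coprime_dvdr _ n6).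
have nR0 : (n%:R : rat) != 0 by rewrite pnatr_eq0 -lt0n.
have /andP[phi3 phiev] := totient_coprime6 n1 n6.
rewrite {}/X; set s := (totient n - 2)%N; set X := _ / _.
have s0 : (0 < s)%N by rewrite subn_gt0 ltnW.
have sev : ~~ odd s by rewrite oddB ?(ltnW (ltnW phi3)) // addbF.
have sR0 : (s%:R : rat) != 0 by rewrite pnatr_eq0 -lt0n.
have sn0 : s%:R * n%:R ^+ 2 != 0 :> rat by rewrite mulf_neq0 ?expf_neq0.
have phiE : totient n = (s.-1 + 3)%N by move: s0; rewrite /s; lia.
have [z1 z1n T1] := congP n _ _ sn0 (coprime_power_sum_bernoulli n1 n6 s0 sev).
have [z2 z2n T2] := congP n _ _ sn0 (coprime_power_sum_double n0 n6 s0).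
set Es := \sum_(_ <= _ < _ | _) _ in T2.
have Esn : Es \in Zloc n by apply: Zloc_sum => j _; rewrite /double_carry; zloc.
have [t tn tE] := expn_totient_cong n0 n2.
(* With [P = 2^(s-1)] and [Y = X + n z1], dividing the doubling relation by [s n] gives
   [(2 P - 1) Y = P Es - n z2]. Multiplying by 8 and using [8 P = 2^phi(n) = 1 + n t] gives the
   claim, an identity in Q with X not yet known to be integral. *)
have key : ((-6)%:~R + n%:R * (2%:R * t)) * (X + n%:R * z1)
    = Es + n%:R * (t * Es - 8%:R * z2).
  have BX : bernoulli_triv_char s n = s%:R * X by rewrite mulrC divfK.
  move: T2; rewrite {}T1 {}BX => T2; rewrite phiE exprD in tE.
  have p2 : 2%:R ^+ s = 2%:R * 2%:R ^+ s.-1 :> rat by rewrite -exprS prednK.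
  rewrite {}p2 in T2; move: (2%:R ^+ s.-1) T2 tE => P T2 tE.
  have {}T2 : 2%:R * P * (X + n%:R * z1) - (X + n%:R * z1) = P * Es - n%:R * z2.
    apply: (mulfI (mulf_neq0 sR0 nR0)); rewrite mulrBr; apply/eqP; rewrite subr_eq; apply/eqP.
    by move: T2; move: (s%:R : rat) (n%:R : rat) => x y T2; lra.
  apply/eqP; rewrite -subr_eq0; apply/eqP.
  set Y := X + _ in T2 *; set Q := (-6)%:~R.
  have -> : (Q + n%:R * (2%:R * t)) * Y - (Es + n%:R * (t * Es - 8%:R * z2))
     = 8%:R * ((2%:R * P * Y - Y) - (P * Es - n%:R * z2))
       - (P * 2%:R ^+ 3 - (1 + n%:R * t)) * (2%:R * Y - Es) by rewrite /Q; ring.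
  by rewrite T2 tE !subrr mulr0 mul0r subr0.
have u6 : coprime `|-6 : int| n by rewrite coprime_sym.
have [U0 Un] := Zloc_inv_add n1 u6 (ZlocM (Zloc_nat n 2) tn).
(* Integrality of X comes from the invertibility of [-6 + 2 n t]. *)
have Yn : X + n%:R * z1 \in Zloc n.
  by rewrite -[X + _](mulKf U0) key; apply: ZlocM Un _; zloc.
have Xn : X \in Zloc n by rewrite -[X](addrK (n%:R * z1)); zloc.
split=> //.
have EsE : cong n n%:R Es (- (6%:R * X)).
  apply/congP => //; exists (- (6%:R * z1) + 2%:R * t * (X + n%:R * z1) - t * Es + 8%:R * z2).
    by zloc.
  rewrite -[LHS](addrK (n%:R * (t * Es - 8%:R * z2))) -key.
  by ring.
(* Since [s - 1 = phi(n) - 3], Euler's theorem turns [j^(s-1)] into [j^-3] modulo n. *)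
have EE : cong n n%:R (\sum_(0 <= j < n | coprime j n) double_carry n j * (j%:R^-1) ^+ 3) Es.
  apply: cong_sum => j jn; have [tj tjn tjE] := expn_totient_cong n0 jn.
  have j0 := coprime_neq0 n1 jn; rewrite phiE exprD in tjE.
  apply/congP => //; exists (- (double_carry n j * tj * j%:R^-1 ^+ 3)).
    by have jin := Zloc_inv jn; rewrite /double_carry; zloc.
  have -> : j%:R ^+ s.-1 = (1 + n%:R * tj) * j%:R^-1 ^+ 3 :> rat.
    by rewrite -tjE exprVn mulfK // expf_neq0.
  by ring.
have h3 : cong n (n%:R ^+ 2) (3%:R * sum_inv2 n) (n%:R * - (6%:R * X)).
  apply: cong_trans (sum_inv2_double n1 n2) _.
  by rewrite expr2 cong_scale //; apply: cong_trans EE EsE.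
have := congMl (Zloc_inv n3) h3; rewrite mulKf //.
by have -> : 3%:R^-1 * (n%:R * - (6%:R * X)) = - (2%:R * n%:R * X) by field.
Qed.

(** * From the square of the product to the product itself *)

Theorem theorem3p5 (n u v : nat) (hn : (1 < n)%N) (hn6 : gcdn n 6 = 1%N)
    (hv : (0 < v)%N) (huv : (v < u)%N) :
  eqmod_rat (n ^ 4)
    (\prod_(d <- divisors n) ('C(u * d, v * d)%:R : rat) ^ moebius (n %/ d))
    (1 - u%:R * v%:R * (v%:R - u%:R)
         * (bernoulli_triv_char (totient n - 2) n / (totient n - 2)%:R)
         * n%:R ^+ 3).
Proof.
have n6 : coprime n 6 by rewrite /coprime hn6.
have n2 : coprime 2 n by rewrite coprime_sym (coprime_dvdr _ n6).
have nR0 : (n%:R : rat) != 0 by rewrite pnatr_eq0 -lt0n ltnW.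
have n40 : (n%:R : rat) ^+ 4 != 0 by rewrite expf_neq0.
have [Xn H2] := sum_inv2_bernoulli hn n6.
rewrite prod_binomial_moebius ?(ltnW huv) //; set w := (u - v)%N.
have uE : u = (v + w)%N by rewrite subnKC // ltnW.
have L2 := coprime_quotient_sqr v w hn n2.
(* Being prime to n^4 is being prime to n, so the goal is membership in [Zloc n]. *)
rewrite /eqmod_rat coprimeXr // natrX.
set X := _ / _ in Xn H2 *; set L := \prod_(_ <= _ < _ | _) _ in L2 *.
(* Both L and the target R are 1 modulo n, so [L + R] is 2 modulo n, hence a unit, and it suffices
   to compare squares. *)
have [z zn LE] : exists2 z, z \in Zloc n & L = 1 + n%:R * z.
  pose b j : rat := v%:R * j%:R^-1.
  have bn j : coprime j n -> b j \in Zloc n.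
    by move=> /Zloc_inv jn; rewrite /b; zloc.
  have [z zn zE] := prod_1D_expand (index_iota 0 (w * n)) (Zloc_nat n n) bn.
  exists (\sum_(0 <= j < w * n | coprime j n) b j + n%:R * z).
    by apply: ZlocD; [apply: Zloc_sum | zloc].
  rewrite mulrDr mulrA -expr2 addrA -zE; apply: eq_bigr => j jn.
  have j0 := coprime_neq0 hn jn; rewrite /b natrD natrM.
  by move: (j%:R : rat) j0 => x x0; field.
have [z4 z4n L2E] := congP n _ _ n40 L2.
have [z2 z2n H2E] := congP n _ _ (expf_neq0 2 nR0) H2.
rewrite uE; set c := u%:R * v%:R * w%:R : rat.
have cn : c \in Zloc n by rewrite /c; zloc.
have -> : 1 - (v + w)%:R * v%:R * (v%:R - (v + w)%:R) * X * n%:R ^+ 3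
    = 1 + c * X * n%:R ^+ 3 by rewrite /c uE natrD; ring.
set R := 1 + _.
have u2 : coprime `|2 : int| n by [].
have rn : z + c * X * n%:R ^+ 2 \in Zloc n by zloc.
have [U0 Un] := Zloc_inv_add hn u2 rn.
have LR : L + R = 2%:~R + n%:R * (z + c * X * n%:R ^+ 2) by rewrite LE /R; ring.
rewrite -LR in U0 Un.
suff e : (L ^+ 2 - R ^+ 2) / n%:R ^+ 4 \in Zloc n.
  have -> : (L - R) / n%:R ^+ 4 = (L + R)^-1 * ((L ^+ 2 - R ^+ 2) / n%:R ^+ 4).
    by rewrite subr_sqr [(L - R) * (L + R)]mulrC -mulrA mulKf.
  exact: ZlocM Un e.
(* Inserting [H = - 2 n X + n^2 z2] into [L^2 = 1 - c n^2 H + n^4 z4] matches [R^2] up to its last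
   term [c^2 X^2 n^6]. *)
have -> : (L ^+ 2 - R ^+ 2) / n%:R ^+ 4 = z4 - c * z2 - c ^+ 2 * X ^+ 2 * n%:R ^+ 2.
  by rewrite L2E H2E /R -uE -/c; field.
by zloc.
Qed.
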